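(* Let $E$ be a finite set with $n=|E|$, let $k$ be a positive integer, let $c_e$ ($e\in E$) be nonnegative integer costs, let $L$ be an integer budget, and let $f:(k+1)^E\to\mathbb{R}_+$ be a monotone $k$-submodular function, accessed through a value oracle. Then the Greedy algorithm for MkK (described in the context), run with $w=4$, returns a feasible $\boldsymbol{s}\in(k+1)^E$ (i.e. $c(P(\boldsymbol{s}))\le L$) satisfying \[ f(\boldsymbol{s})\ \ge\ \tfrac{1}{2}(1-e^{-2})\, f(\boldsymbol{o}), \] where $\boldsymbol{o}$ is an optimal solution of the problem $\max\{f(\boldsymbol{x}) : \boldsymbol{x}\in(k+1)^E,\ c(P(\boldsymbol{x}))\le L\}$. Moreover, the algorithm uses $O(n^6k^5)$ queries of the value of $f$.
   Context: For $k\ge1$ let $[k]=\{1,\dots,k\}$ and $(k+1)^E=\{(X_1,\dots,X_k): X_i\subseteq E,\ X_i\cap X_j=\varnothing \text{ for } i\ne j\}$. For $\boldsymbol{x}=(X_1,\dots,X_k)$, $\boldsymbol{y}=(Y_1,\dots,Y_k)$ define $\boldsymbol{x}\sqcup\boldsymbol{y}$ as the tuple whose $i$-th component is $(X_i\cup Y_i)\setminus\bigcup_{j\ne i}(X_j\cup Y_j)$, and $\boldsymbol{x}\sqcap\boldsymbol{y}=(X_1\cap Y_1,\dots,X_k\cap Y_k)$. A function $f:(k+1)^E\to\mathbb{R}_+$ is $k$-submodular if $f(\boldsymbol{x})+f(\boldsymbol{y})\ge f(\boldsymbol{x}\sqcup\boldsymbol{y})+f(\boldsymbol{x}\sqcap\boldsymbol{y})$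 for all $\boldsymbol{x},\boldsymbol{y}$. Write $\boldsymbol{x}\preceq\boldsymbol{y}$ if $X_i\subseteq Y_i$ for all $i$; $f$ is monotone if $\boldsymbol{x}\preceq\boldsymbol{y}$ implies $f(\boldsymbol{x})\le f(\boldsymbol{y})$. The support is $P(\boldsymbol{x})=\bigcup_i X_i$, and $c(S)=\sum_{e\in S}c_e$. Let $\boldsymbol{I}_{[e,i]}$ be the tuple whose $i$-th set is $\{e\}$ and all others empty, and for $e\notin P(\boldsymbol{x})$ let $\Delta_{e,i}f(\boldsymbol{x})=f(\boldsymbol{x}\sqcup\boldsymbol{I}_{[e,i]})-f(\boldsymbol{x})$. Greedy algorithm for MkK with parameter $w$: (1) Set $\boldsymbol{s}$ to a maximizer of $f(\boldsymbol{s}_0)$ over all $\boldsymbol{s}_0\in(k+1)^E$ with $|P(\boldsymbol{s}_0)|\le w-1$ and $c(P(\boldsymbol{s}_0))\le L$. (2) For every $\boldsymbol{s}^0\in(k+1)^E$ with $|P(\boldsymbol{s}^0)|=w$ and $c(P(\boldsymbol{s}^0))\le L$: set $E^0=E\setminus P(\boldsymbol{s}^0)$, $j=1$; while $E^{j-1}\neq\varnothing$: choose $(e^j,i^j)\in\arg\max_{e\in E^{j-1},\,i\in[k]}\Delta_{e,i}f(\boldsymbol{s}^{j-1})/c_e$; if $c(P(\boldsymbol{s}^{j-1}))+c_{e^j}\le L$ set $\boldsymbol{s}^j=\boldsymbol{s}^{j-1}\sqcup\boldsymbol{I}_{[e^j,i^j]}$, else set $\boldsymbol{s}^j=\boldsymbol{s}^{j-1}$;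 set $E^j=E^{j-1}\setminus\{e^j\}$ and $j\leftarrow j+1$. When the loop ends, replace $\boldsymbol{s}$ by the better (w.r.t. $f$) of $\boldsymbol{s}$ and the final $\boldsymbol{s}^{j}$. (3) Return $\boldsymbol{s}$.
   Formalization: For elements of cost zero, where the ratio Δ/c_e in the greedy choice is undefined, 0/0 is read as 0 and a positive gain over 0 as larger than every finite ratio, two such ratios being compared by their gains; for positive costs the algorithm is unchanged. *)

(* Defs.v *)
From HB Require Import structures.
From mathcomp Require Import all_boot all_order all_algebra.
From mathcomp Require Import reals.

Set Implicit Arguments.
Unset Strict Implicit.
Unset Printing Implicit Defensive.

Import Order.TTheory GRing.Theory Num.Theory.

Local Open Scope ring_scope.

Definition pairwise_disjoint (E : finType) (k : nat)
    (X : {ffun 'I_k -> {set E}}) : bool :=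
  [forall i, forall j, (i != j) ==> [disjoint X i & X j]].

(* The set (k+1)^E; components are indexed by 0, ..., k-1. *)
Record ktuple (E : finType) (k : nat) := KTuple {
  ktuple_val :> {ffun 'I_k -> {set E}};
  ktuple_disjoint : pairwise_disjoint ktuple_val
}.

HB.instance Definition _ (E : finType) (k : nat) :=
  [isSub for @ktuple_val E k].
HB.instance Definition _ (E : finType) (k : nat) :=
  [Finite of ktuple E k by <:].

Section Operations.
Variables (E : finType) (k : nat).
Implicit Types x y : ktuple E k.

Lemma kjoin_disjoint x y :
  pairwise_disjoint [ffun i : 'I_k =>
    (x i :|: y i) :\: \bigcup_(j | j != i) (x j :|: y j)].
Proof.
apply/forallP => i; apply/forallP => j; apply/implyP => ij.
rewrite !ffunE; apply/pred0P => e /=; apply/negbTE/negP.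
move=> /andP[/setDP[_ ei] /setDP[ej _]].
by case/negP: ei; apply/bigcupP; exists j => //; rewrite eq_sym.
Qed.

Definition kjoin x y : ktuple E k := KTuple (kjoin_disjoint x y).

Lemma kmeet_disjoint x y :
  pairwise_disjoint [ffun i : 'I_k => x i :&: y i].
Proof.
apply/forallP => i; apply/forallP => j; apply/implyP => ij.
have /forallP/(_ i)/forallP/(_ j)/implyP/(_ ij) := ktuple_disjoint x.
rewrite !ffunE => dx.
exact: disjointWl (subsetIl _ _) (disjointWr (subsetIl _ _) dx).
Qed.

Definition kmeet x y : ktuple E k := KTuple (kmeet_disjoint x y).

Definition kle x y : Prop := forall i : 'I_k, x i \subset y i.

Definition ksupport x : {set E} := \bigcup_(i < k) x i.

Lemma ksingle_disjoint (e : E) (i : 'I_k) :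
  pairwise_disjoint [ffun j : 'I_k => if j == i then [set e] else set0].
Proof.
apply/forallP => j; apply/forallP => l; apply/implyP => jl.
rewrite !ffunE -setI_eq0.
case: (eqVneq j i) => [ji|_]; last by rewrite set0I.
case: (eqVneq l i) => [li|_]; last by rewrite setI0.
by rewrite ji li eqxx in jl.
Qed.

(* The tuple I_[e,i]. *)
Definition ksingle (e : E) (i : 'I_k) : ktuple E k :=
  KTuple (ksingle_disjoint e i).

Definition ksubmodular (R : realType) (f : ktuple E k -> R) : Prop :=
  forall x y, f (kjoin x y) + f (kmeet x y) <= f x + f y.

Definition kmonotone (R : realType) (f : ktuple E k -> R) : Prop :=
  forall x y, kle x y -> f x <= f y.

Definition cost (c : E -> nat) (S : {set E}) : nat := (\sum_(e in S) c e)%N.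

Definition feasible (c : E -> nat) (L : int) x : bool :=
  (cost c (ksupport x))%:Z <= L.

Definition optimal (R : realType) (f : ktuple E k -> R) (c : E -> nat)
    (L : int) (o : ktuple E k) : Prop :=
  feasible c L o /\ forall x, feasible c L x -> f x <= f o.

End Operations.

(* Nondeterministic programs that can read a function X -> Y only through
   value queries.  [Choose s next] continues with an arbitrary element of [s];
   it is how ties in an arg max are broken. *)
Inductive prog (X Y A : Type) : Type :=
| Ret (a : A)
| Query (x : X) (next : Y -> prog X Y A)
| Choose (T : eqType) (s : seq T) (next : T -> prog X Y A).

Arguments Ret {X Y A} a.
Arguments Query {X Y A} x next.
Arguments Choose {X Y A T} s next.

Fixpoint bind (X Y A B : Type) (p : prog X Y A) (g : A -> prog X Y B) :
    prog X Y B :=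
  match p with
  | Ret a => g a
  | Query x next => Query x (fun y => bind (next y) g)
  | Choose T s next => Choose s (fun t => bind (next t) g)
  end.

(* [runs f p a q]: with oracle [f], some execution of [p] returns [a] after
   exactly [q] queries.  A choice from the empty list is stuck. *)
Fixpoint runs (X Y A : Type) (f : X -> Y) (p : prog X Y A) (a : A) (q : nat) :
    Prop :=
  match p with
  | Ret b => a = b /\ q = 0%N
  | Query x next => exists2 q', q = q'.+1 & runs f (next (f x)) a q'
  | Choose T s next => exists2 t, t \in s & runs f (next t) a q
  end.

Section Greedy.
Variables (R : realType) (E : finType) (k : nat) (c : E -> nat) (L : int).

Local Notation oprog := (prog (ktuple E k) R).

(* Query [g t] for every [t] in [ts]; return the list of pairs [(t, f (g t))]. *)
Fixpoint ask_all (T : Type) (g : T -> ktuple E k) (ts : seq T) :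
    oprog (seq (T * R)) :=
  match ts with
  | [::] => Ret [::]
  | t :: ts' =>
      Query (g t) (fun v => bind (ask_all g ts') (fun r => Ret ((t, v) :: r)))
  end.

(* An arbitrary maximizer, over the listed pairs, of the preorder [le]. *)
Definition choose_max (T : eqType) (le : rel (T * R)) (ps : seq (T * R)) :
    oprog T :=
  Choose [seq p.1 | p <- ps & all (fun p' => le p' p) ps] (fun t => Ret t).

Definition ask_argmax (xs : seq (ktuple E k)) : oprog (ktuple E k) :=
  bind (ask_all id xs) (choose_max (fun p p' => p.2 <= p'.2)).

(* [d / a <= d' / a'] for gains d, d' >= 0 and costs a, a'.  A zero cost is
   read as an infinitesimal one: 0 / 0 is 0, and d / 0 with d > 0 exceeds every
   finite ratio, two such ratios being compared by their numerators.  (If all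
   the infinite ratios were tied, the arg max could add a free element at an
   arbitrarily bad index, and the approximation guarantee would fail.) *)
Definition ratio_le (d : R) (a : nat) (d' : R) (a' : nat) : bool :=
  match a, a' with
  | 0%N, 0%N => d <= d'
  | 0%N, _.+1 => d <= 0
  | _.+1, 0%N => (d <= 0) || (0 < d')
  | _.+1, _.+1 => d / a%:R <= d' / a'%:R
  end.

(* [v0] is the value of the current tuple, and a pair [((e, i), v)] records the
   value [v] of that tuple after adding [e] to its [i]-th component. *)
Definition gain_ratio_le (v0 : R) (p p' : (E * 'I_k) * R) : bool :=
  ratio_le (p.2 - v0) (c p.1.1) (p'.2 - v0) (c p'.1.1).

(* [m] bounds the number of iterations; every iteration removes one element
   from [A], so [m = #|A|] runs the loop until [A] is empty. *)
Fixpoint greedy_loop (m : nat) (s : ktuple E k) (A : {set E}) :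
    oprog (ktuple E k) :=
  match m with
  | 0%N => Ret s
  | m'.+1 =>
      if A == set0 then Ret s else
      Query s (fun v0 =>
      bind (ask_all (fun ei : E * 'I_k => kjoin s (ksingle ei.1 ei.2))
                    [seq (e, i) | e <- enum A, i <- enum 'I_k]) (fun ps =>
      bind (choose_max (gain_ratio_le v0) ps) (fun ei =>
      greedy_loop m'
        (if (cost c (ksupport s) + c ei.1)%:Z <= L
         then kjoin s (ksingle ei.1 ei.2) else s)
        (A :\ ei.1))))
  end.

Fixpoint greedy_starts (starts : seq (ktuple E k)) (s : ktuple E k) :
    oprog (ktuple E k) :=
  match starts with
  | [::] => Ret s
  | s0 :: starts' =>
      let A := ~: ksupport s0 in
      bind (greedy_loop #|A| s0 A) (fun t =>
      bind (ask_argmax [:: s; t]) (fun s' =>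
      greedy_starts starts' s'))
  end.

Definition greedy (w : nat) : oprog (ktuple E k) :=
  bind (ask_argmax [seq x <- enum {: ktuple E k} |
                      (#|ksupport x| <= w - 1)%N && feasible c L x]) (fun s =>
  greedy_starts [seq x <- enum {: ktuple E k} |
                   (#|ksupport x| == w) && feasible c L x] s).

End Greedy.

(* Main.v *)
(* Let [o] be optimal with at least four elements, and start the greedy run from
   an [s0 <= o] with four elements of maximal value.  Let [e] be the first
   element of [o] that is rejected for lack of budget; it is compared not with
   [o] but with [x], which is [o] without [e], so that no loss is incurred for
   [e] itself.  Keeping a copy [y] of [x] that is relabelled to agree with the
   current state [s], one has [f y + f s >= f x + f s0] because greedy picks the
   best label of each element, hence the gap [D = f x + f s0 - 2 f s] is at most
   [f y - f s], and by submodularity at most [B] times the greedy ratio, where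
   [B] is the cost of [x] outside [s0].  Adding an element of cost [c] thus
   multiplies [D] by at most [1 - 2 c / B <= exp (- 2 c / B)].  When [e] does not
   fit, the accepted elements cost at least [B], and so
   [2 f s >= (1 - exp (- 2)) (f x + f s0)], where [f x + f s0 >= f o] by the
   choice of [s0]. *)
Require Import Defs.
From mathcomp Require Import all_boot all_order all_algebra.
From mathcomp Require Import reals sequences exp.
From mathcomp Require Import zify lra.

Set Implicit Arguments.
Unset Strict Implicit.
Unset Printing Implicit Defensive.

Import Order.TTheory GRing.Theory Num.Theory.

Local Open Scope ring_scope.

(** * Tuples as partial labellings of the ground set *)

Section Labels.
Variables (E : finType) (k : nat).
Implicit Types (x y z : ktuple E k) (e : E) (i : 'I_k) (S : {set E}).

(** Since the components are disjoint, a tuple is the same as a partial map from [E] to ['I_k];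
    join, meet and order then act element by element. *)
Definition klabel x e : option 'I_k := [pick i | e \in x i].

Lemma klabelE x e i : (klabel x e == Some i) = (e \in x i).
Proof.
rewrite /klabel; case: pickP => [j ej|/(_ i) -> //].
apply/eqP/idP => [[<-] //|ei].
have [-> //|ij] := eqVneq i j.
have /forallP/(_ i)/forallP/(_ j)/implyP/(_ ij)/pred0P/(_ e) := ktuple_disjoint x.
by rewrite /= ei ej.
Qed.

Lemma klabel_inj x y : klabel x =1 klabel y -> x = y.
Proof.
move=> xy; apply/val_inj/ffunP => i; apply/setP => e.
by rewrite -!klabelE xy.
Qed.

Lemma klabel_eq x e (l : option 'I_k) :
  (forall i, (e \in x i) = (l == Some i)) -> klabel x e = l.
Proof.
move=> xl; case: l xl => [i|] xl; first by apply/eqP; rewrite klabelE xl.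
by case El: (klabel x e) => [i|//]; move/eqP: El; rewrite klabelE xl.
Qed.

Lemma ksupportE x e : (e \in ksupport x) = (klabel x e != None).
Proof.
apply/bigcupP/idP => [[i _]|]; first by rewrite -klabelE => /eqP->.
by case El: (klabel x e) => [i|//] _; exists i => //; rewrite -klabelE El.
Qed.

Lemma kleP x y :
  kle x y <-> (forall e i, klabel x e = Some i -> klabel y e = Some i).
Proof.
split=> [xy e i /eqP|xy i].
  by rewrite klabelE => /(subsetP (xy i)) ei; apply/eqP; rewrite klabelE.
by apply/subsetP => e; rewrite -!klabelE => /eqP/xy->.
Qed.

Lemma klabel_single e i e' :
  klabel (ksingle e i) e' = if e' == e then Some i else None.
Proof.
apply: klabel_eq => j; rewrite ffunE; have [->|ji] := eqVneq j i.
  by rewrite inE; case: (e' == e); rewrite ?eqxx.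
by rewrite inE; case: (e' == e) => //; apply/esym/negbTE; apply: contraNN ji => /eqP[->].
Qed.

Lemma klabel_meet x y e :
  klabel (kmeet x y) e = if klabel x e == klabel y e then klabel x e else None.
Proof.
apply: klabel_eq => i; rewrite ffunE inE -!klabelE.
have [->|xy] := eqVneq (klabel x e) (klabel y e); first by rewrite andbb.
by apply/negP => /andP[/eqP xi /eqP yi]; rewrite xi yi eqxx in xy.
Qed.

Lemma klabel_join x y e :
  klabel (kjoin x y) e =
  match klabel x e, klabel y e with
  | None, l | l, None => l
  | Some i, Some j => if i == j then Some i else None
  end.
Proof.
apply: klabel_eq => i; rewrite ffunE in_setD in_setU -!klabelE.
have bigcupE : (e \in \bigcup_(j | j != i) (x j :|: y j)) =
    (if klabel x e is Some a then a != i else false) ||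
    (if klabel y e is Some b then b != i else false).
  apply/bigcupP/orP => [[j ji]|].
    by rewrite in_setU -!klabelE => /orP[] /eqP->; [left|right].
  case=> [|]; [case Ex: (klabel x e) => [a|//]|case Ex: (klabel y e) => [a|//]];
    by move=> ai; exists a => //; rewrite in_setU -!klabelE Ex eqxx ?orbT.
rewrite {}bigcupE.
have someE (a b : 'I_k) : (Some a == Some b) = (a == b) by [].
case: (klabel x e) => [a|]; case: (klabel y e) => [b|] //=.
- have [<-|ab] := eqVneq a b; first by rewrite !orbb negbK andbb.
  rewrite !someE.
  by have [ai|ai] := eqVneq a i; have [bi|bi] := eqVneq b i; rewrite // ai bi eqxx in ab.
- by rewrite orbF negbK someE orbF andbb.
- by rewrite negbK someE andbb.
Qed.

Lemma kjoin_single x e i : klabel x e = None ->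
  klabel (kjoin x (ksingle e i)) =1 [eta klabel x with e |-> Some i].
Proof.
move=> xe e' /=; rewrite klabel_join klabel_single.
by have [->|_] := eqVneq e' e; rewrite ?xe //; case: (klabel x e').
Qed.

Lemma ksupport_join_single x e i : e \notin ksupport x ->
  ksupport (kjoin x (ksingle e i)) = e |: ksupport x.
Proof.
rewrite ksupportE negbK => /eqP xe; apply/setP => e'.
by rewrite in_setU1 !ksupportE kjoin_single //=; case: (e' == e).
Qed.

Lemma kle_join_single x e i : e \notin ksupport x ->
  kle x (kjoin x (ksingle e i)).
Proof.
rewrite ksupportE negbK => /eqP xe; apply/kleP => e' j.
by rewrite kjoin_single //=; case: eqVneq => // ->; rewrite xe.
Qed.

Lemma kle_trans y x z : kle x y -> kle y z -> kle x z.
Proof. by move=> xy yz i; apply: subset_trans (xy i) (yz i). Qed.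

Lemma kle_support x y : kle x y -> ksupport x \subset ksupport y.
Proof.
move=> /kleP xy; apply/subsetP => e; rewrite !ksupportE.
by case El: (klabel x e) => [i|//]; rewrite (xy _ _ El).
Qed.

Lemma kle_support_eq x y : kle x y -> ksupport y \subset ksupport x -> x = y.
Proof.
move=> /kleP xy /subsetP yx; apply: klabel_inj => e.
case xe: (klabel x e) => [i|]; first by rewrite (xy _ _ xe).
case ye: (klabel y e) => [j|//].
by have := yx e; rewrite !ksupportE ye xe => /(_ isT).
Qed.

Lemma krestrict_disjoint x S :
  pairwise_disjoint [ffun i => x i :&: S].
Proof.
apply/forallP => i; apply/forallP => j; apply/implyP => ij.
have /forallP/(_ i)/forallP/(_ j)/implyP/(_ ij) := ktuple_disjoint x.
by rewrite !ffunE; apply: disjointW; apply: subsetIl.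
Qed.

Definition krestrict x S : ktuple E k := KTuple (krestrict_disjoint x S).

Lemma klabel_restrict x S e :
  klabel (krestrict x S) e = if e \in S then klabel x e else None.
Proof.
apply: klabel_eq => i; rewrite ffunE inE -klabelE.
by case: (e \in S); rewrite ?andbT ?andbF.
Qed.

Lemma ksupport_restrict x S : ksupport (krestrict x S) = ksupport x :&: S.
Proof.
apply/setP => e; rewrite inE !ksupportE klabel_restrict.
by case: (e \in S); rewrite ?andbT ?andbF.
Qed.

Lemma krestrict_le x S : kle (krestrict x S) x.
Proof. by apply/kleP => e i; rewrite klabel_restrict; case: (e \in S). Qed.

Lemma kle_restrict x y S :
  kle x y -> ksupport x \subset S -> kle x (krestrict y S).
Proof.
move=> /kleP xy /subsetP xS; apply/kleP => e i xe.
by rewrite klabel_restrict xS ?ksupportE ?xe ?(xy _ _ xe).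
Qed.

Lemma krestrictD1_join x e i : klabel x e = Some i ->
  kjoin (krestrict x [set~ e]) (ksingle e i) = x.
Proof.
move=> xe; apply: klabel_inj => e'.
rewrite kjoin_single /= ?klabel_restrict ?inE ?eqxx //.
by case: eqVneq => [->|].
Qed.

Lemma notin_krestrictD1 x e : e \notin ksupport (krestrict x [set~ e]).
Proof. by rewrite ksupportE klabel_restrict !inE eqxx. Qed.

End Labels.

(** * Marginal gains *)

Section Submodular.
Variables (R : realType) (E : finType) (k : nat) (f : ktuple E k -> R).
Hypotheses (f_mono : kmonotone f) (f_sub : ksubmodular f).
Implicit Types (x y s : ktuple E k) (e : E) (i : 'I_k).

Definition gain x e i : R := f (kjoin x (ksingle e i)) - f x.

Lemma gain_ge0 x e i : e \notin ksupport x -> 0 <= gain x e i.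
Proof. by move=> xe; rewrite subr_ge0; apply/f_mono/kle_join_single. Qed.

(** This is k-submodularity for [kjoin x (ksingle e i)] and [y]: as [e] is unlabelled in [y], their
    join is [kjoin y (ksingle e i)] and their meet is [x]. *)
Lemma gain_antimono x y e i : kle x y -> e \notin ksupport y ->
  gain y e i <= gain x e i.
Proof.
move=> xy ye; have xe : e \notin ksupport x.
  by apply: contraNN ye; apply/subsetP/kle_support.
move: (ye) (xe); rewrite !ksupportE !negbK => /eqP yeN /eqP xeN.
have := f_sub (kjoin x (ksingle e i)) y.
have -> : kjoin (kjoin x (ksingle e i)) y = kjoin y (ksingle e i).
  apply: klabel_inj => e'; rewrite klabel_join !kjoin_single //=.
  have [->|_] := eqVneq e' e; first by rewrite yeN.
  case Ex: (klabel x e') => [j|//].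
  by move/kleP: xy => /(_ _ _ Ex) ->; rewrite eqxx.
have -> : kmeet (kjoin x (ksingle e i)) y = x.
  apply: klabel_inj => e'; rewrite klabel_meet !kjoin_single //=.
  have [->|_] := eqVneq e' e; first by rewrite yeN xeN.
  case Ex: (klabel x e') => [j|]; last by case: (klabel y e').
  by move/kleP: xy => /(_ _ _ Ex) ->; rewrite eqxx.
by rewrite /gain lerBlDr addrAC lerBrDr => /le_trans->.
Qed.

(** Strip the elements of [y] outside [s] one at a time: removing [e] costs the gain of [e] at the
    rest of [y], which lies above [s], so by [gain_antimono] this is at most the gain at [s]. *)
Lemma le_sum_gain (h : E -> R) s y :
  kle s y ->
  (forall e i, klabel y e = Some i -> e \notin ksupport s -> gain s e i <= h e) ->
  f y <= f s + \sum_(e in ksupport y :\: ksupport s) h e.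
Proof.
elim: {y}_.+1 {-2}y (ltnSn #|ksupport y|) => // n IHn y yn sy hs.
have [/eqP|[e]] := set_0Vmem (ksupport y :\: ksupport s).
  by rewrite setD_eq0 => ys; rewrite (kle_support_eq sy ys) setDv big_set0 addr0.
rewrite inE => /andP[se]; rewrite ksupportE.
case ye: (klabel y e) => [i|//] _.
set z := krestrict y [set~ e].
have sz : kle s z.
  by apply: kle_restrict => //; apply/subsetP => e' se'; rewrite !inE; apply: contraNneq se => <-.
have zE : ksupport z = ksupport y :\ e by rewrite ksupport_restrict setDE.
have ey : e \in ksupport y by rewrite ksupportE ye.
rewrite (big_setD1 e) /= ?inE ?se ?ey //.
have := IHn z; rewrite zE.
have -> : (ksupport y :\ e) :\: ksupport s = (ksupport y :\: ksupport s) :\ e.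
  by apply/setP => e'; rewrite !inE andbCA.
move=> /(_ _ sz) IH.
have: f z <= f s + \sum_(i in (ksupport y :\: ksupport s) :\ e) h i.
  apply: IH; first by move: yn; rewrite (cardsD1 e) ey ltnS.
  move=> e' j; rewrite klabel_restrict; case: ifP => // _; exact: hs.
have: gain z e i <= h e.
  by apply: le_trans (hs _ _ ye se); apply: gain_antimono => //; apply: notin_krestrictD1.
rewrite /gain krestrictD1_join // lerBlDr => /le_trans yz zs.
by apply: yz; rewrite addrCA lerD2l.
Qed.

End Submodular.

(** Serves to compare the labels of one element, whose cost is the same for all of them, zero
    included. *)
Lemma ratio_le_same_cost (R : realType) (d d' : R) (a : nat) :
  ratio_le d a d' a -> d <= d'.
Proof. by case: a => //= a; rewrite ler_pM2r // invr_gt0 ltr0n. Qed.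

(** For [a = 0] and [a' > 0] the convention of [ratio_le] forces [d <= 0], so the bound survives
    free elements. *)
Lemma ratio_leM (R : realType) (d d' : R) (a a' : nat) :
  (0 < a')%N -> ratio_le d a d' a' -> d <= a%:R * (d' / a'%:R).
Proof.
case: a' => // a' _; case: a => [|a] /=; first by rewrite mul0r.
by rewrite ler_pdivrMr ?ltr0n // mulrC.
Qed.

(** * The invariant of a greedy run *)

Section Invariant.
Variables (R : realType) (E : finType) (k : nat) (c : E -> nat).
Variables (f : ktuple E k -> R) (f_mono : kmonotone f) (f_sub : ksubmodular f).
Implicit Types (x y s : ktuple E k) (e : E) (i : 'I_k) (S T A : {set E}).

Lemma costS S T : S \subset T -> (cost c S <= cost c T)%N.
Proof. by move=> ST; rewrite /cost [leqRHS](big_setID S) /= (setIidPr ST) leq_addr. Qed.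

Lemma costU1 S e : e \notin S -> cost c (e |: S) = (c e + cost c S)%N.
Proof. by move=> eS; rewrite /cost big_setU1. Qed.

Lemma costD S T : S \subset T -> (cost c S + cost c (T :\: S) = cost c T)%N.
Proof. by move=> ST; rewrite /cost [RHS](big_setID S) /= (setIidPr ST). Qed.

Definition best_gain s A e i : Prop :=
  e \in A /\ forall e' i', e' \in A ->
    ratio_le (gain f s e' i') (c e') (gain f s e i) (c e).

(* [s0] is the start of the greedy run, [s] its current state and [x] the
   competitor; [y] is [x] relabelled to agree with [s]. *)
Definition invariant s0 x s : Prop :=
  (exists y, [/\ kle s y, ksupport y \subset ksupport x :|: ksupport s &
                 f x + f s0 <= f y + f s]) /\
  let b : R := (cost c (ksupport x :\: ksupport s0))%:R in
  (0 < b -> f x + f s0 - 2 * f s <=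
    (f x - f s0) * expR (- 2 * ((cost c (ksupport s :\: ksupport s0))%:R / b))).

Lemma invariant_start s0 x : kle s0 x -> invariant s0 x s0.
Proof.
move=> s0x; split; first by exists x; split; rewrite ?subsetUl.
by move=> b _; rewrite setDv /cost big_set0 mul0r mulr0 expR0; lra.
Qed.

Section Step.
Variables (s0 x s : ktuple E k) (A : {set E}) (e : E) (i : 'I_k).
Hypotheses (s0x : kle s0 x) (s0s : kle s0 s) (inv_s : invariant s0 x s).
Hypotheses (xA : ksupport x \subset ksupport s :|: A).
Hypotheses (sA : A \subset ~: ksupport s) (best : best_gain s A e i).

Let es : e \notin ksupport s.
Proof. by case: best => eA _; have := subsetP sA _ eA; rewrite inE. Qed.

(** The gap is at most [f y - f s], hence at most the sum of gains at [s] over the elements of [y]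
    outside [s]. These are still in [A], so each gain is at most its cost times the greedy ratio,
    and they lie in [x] outside [s0]. The division is cleared so that [c e = 0] is covered. *)
Lemma gap_gain : (f x + f s0 - 2 * f s) * (c e)%:R <=
  (cost c (ksupport x :\: ksupport s0))%:R * gain f s e i.
Proof.
have g0 : 0 <= gain f s e i by apply: gain_ge0.
have [->|ce] := posnP (c e); first by rewrite mulr0 mulr_ge0.
have [[y [sy yx fy]] _] := inv_s.
have ySA : ksupport y :\: ksupport s \subset A.
  apply/subsetP => e'; rewrite inE => /andP[e's /(subsetP yx)].
  rewrite inE (negbTE e's) orbF => /(subsetP xA).
  by rewrite inE (negbTE e's).
have yS0 : ksupport y :\: ksupport s \subset ksupport x :\: ksupport s0.
  apply/subsetP => e'; rewrite !inE => /andP[e's /(subsetP yx)].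
  rewrite inE (negbTE e's) orbF => ->; rewrite andbT.
  by apply: contraNN e's; apply/subsetP/kle_support.
set r := gain f s e i / (c e)%:R.
have r0 : 0 <= r by rewrite divr_ge0.
have : f y <= f s + \sum_(e' in ksupport y :\: ksupport s) (c e')%:R * r.
  apply: (le_sum_gain f_sub sy) => e' j ye' se'; apply: ratio_leM => //.
  apply: (proj2 best); apply: (subsetP ySA).
  by rewrite inE se' ksupportE ye'.
rewrite -mulr_suml -natr_sum => fys.
have : f x + f s0 - 2 * f s <= (cost c (ksupport x :\: ksupport s0))%:R * r.
  apply: (@le_trans _ _ (f y - f s)); first by lra.
  rewrite lerBlDl; apply: le_trans fys _; rewrite lerD2l ler_wpM2r //.
  by rewrite ler_nat; apply: costS.
by rewrite mulrA ler_pdivlMr // ltr0n.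
Qed.

Lemma invariant_step : invariant s0 x (kjoin s (ksingle e i)).
Proof.
have [[y [sy yx fy]] dec] := inv_s.
have fjoin : f (kjoin s (ksingle e i)) = f s + gain f s e i by rewrite /gain addrC subrK.
have g0 : 0 <= gain f s e i by apply: gain_ge0.
split.
  (* The new copy is [y] with [e] relabelled [i]. Passing through [z], which is [y] without [e],
     loses at most [gain f s e i], exactly what [s] wins; putting [e] back loses nothing by
     monotonicity. *)
  set z := krestrict y [set~ e]; exists (kjoin z (ksingle e i)).
  have sz : kle s z.
    by apply: kle_restrict => //; apply/subsetP => e' se'; rewrite !inE; apply: contraNneq es => <-.
  have ez : e \notin ksupport z by apply: notin_krestrictD1.
  split.
  - apply/kleP => e' j; move: (ez) es; rewrite !ksupportE !negbK => /eqP ze /eqP se.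
    by rewrite !kjoin_single //=; case: eqVneq => // _; move/kleP: sz; apply.
  - rewrite !ksupport_join_single // ksupport_restrict.
    apply/subsetP => e'; rewrite !inE => /orP[->|/andP[/(subsetP yx)]].
      by rewrite orbT.
    by rewrite inE => /orP[] ->; rewrite ?orbT.
  - rewrite fjoin; apply: (le_trans fy).
    suff : f y <= f z + gain f s e i.
      by have := f_mono (kle_join_single i ez); lra.
    (* If [y] gives [e] the label [j], the loss is at most the gain of [(e, j)] at [s], which greedy
       did not prefer to [(e, i)]; otherwise [z] is already above [y]. *)
    case ye: (klabel y e) => [j|].
      have := gain_antimono f_sub j sz ez; rewrite {1}/gain krestrictD1_join //.
      have := ratio_le_same_cost (proj2 best e j (proj1 best)); lra.
    have : f y <= f z by apply/f_mono/kle_restrict => //; rewrite subsetC sub1set inE ksupportE ye.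
    lra.
move=> b b0; have := dec b0; have := gap_gain; rewrite -/b fjoin.
have es0 : e \notin ksupport s0.
  by apply: contraNN es; apply/subsetP/kle_support.
rewrite ksupport_join_single // setDUl.
have -> : [set e] :\: ksupport s0 = [set e].
  by apply/setDidPl; rewrite disjoints1.
rewrite costU1; last by rewrite inE (negbTE es) andbF.
rewrite natrD (mulrDl _ _ b^-1) (mulrDr (- 2)) expRD.
set D := _ - 2 * f s; set u := expR (_ * (_ / b)); set v := expR _.
move=> gap Dv.
have fx0 : 0 <= f x - f s0 by rewrite subr_ge0; apply: f_mono.
have u0 : 0 < u by apply: expR_gt0.
have v0 : 0 < v by apply: expR_gt0.
have -> : f x + f s0 - 2 * (f s + gain f s e i) = D - 2 * gain f s e i by rewrite /D; lra.
(* The new gap is [D - 2 * gain f s e i]. Multiplying [D] into [1 + t <= expR t] needs [D > 0]; for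
   [D <= 0] the right-hand side is nonnegative anyway. *)
have [D0|D0] := leP D 0.
  by apply: (@le_trans _ _ 0); [lra|rewrite !mulr_ge0 // ltW].
have {}gap : D * ((c e)%:R / b) <= gain f s e i by rewrite mulrA ler_pdivrMr // [leRHS]mulrC.
apply: (@le_trans _ _ (D * v)); last by rewrite mulrCA mulrC ler_pM2l.
apply: (@le_trans _ _ (D * (1 + - 2 * ((c e)%:R / b)))); first by rewrite [leRHS]mulrDr mulr1 mulrCA; lra.
by rewrite ler_pM2l //; apply: expR_ge1Dx.
Qed.

Lemma invariant_bound : 0 <= f s0 -> (0 < c e)%N ->
  (cost c (ksupport x) <= cost c (ksupport s))%N ->
  (1 - expR (- 2)) * (f x + f s0) <= 2 * f s.
Proof.
move=> f0 ce xs; have [_ dec] := inv_s; have gap := gap_gain.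
have fx0 : 0 <= f x - f s0 by rewrite subr_ge0; apply: f_mono.
have u0 : 0 < expR (- 2) :> R by apply: expR_gt0.
have u1 : 0 <= expR (- 2) * f s0 by rewrite mulr_ge0 // ltW.
have u2 : 0 <= expR (- 2) * (f x - f s0) by rewrite mulr_ge0 // ltW.
suff : f x + f s0 - 2 * f s <= (f x - f s0) * expR (- 2) by lra.
move: dec gap; set b := (_)%:R => dec gap.
(* For [b = 0] the decay bound says nothing, but [gap_gain] with [c e > 0] makes the gap
   nonpositive. *)
have [b0|] := ltP 0 b; last first.
  rewrite /b lern0 => /eqP b0; move: gap; rewrite /b b0 mul0r.
  rewrite pmulr_lle0 ?ltr0n // => gap; lra.
apply: (le_trans (dec b0)); rewrite ler_wpM2l // ler_expR.
suff : 1 <= (cost c (ksupport s :\: ksupport s0))%:R / b by lra.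
rewrite ler_pdivlMr // mul1r ler_nat.
(* Both [x] and [s] contain [s0], so removing its cost from each side of [cost x <= cost s] makes
   the accepted cost at least [b]. *)
by rewrite -(leq_add2l (cost c (ksupport s0))) !costD //; apply: kle_support.
Qed.

End Step.
End Invariant.

(** * Runs of composed programs and of the query primitives *)

Section Programs.
Variables (X Y : Type) (f : X -> Y).

Lemma runs_bind A B (p : prog X Y A) (g : A -> prog X Y B) b q :
  runs f (bind p g) b q <->
  exists a q1 q2, [/\ runs f p a q1, runs f (g a) b q2 & q = (q1 + q2)%N].
Proof.
elim: p q => [a|x next IH|T ts next IH] q /=.
- split=> [r|[_ [_ [q2 [[-> ->] r ->]]]] //]; by exists a, 0%N, q.
- split=> [[q' -> /IH[a [q1 [q2 [r1 r2 ->]]]]]|[a [_ [q2 [[q1 -> r1] r2 ->]]]]].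
    by exists a, q1.+1, q2; split=> //; exists q1.
  by exists (q1 + q2)%N => //; apply/IH; exists a, q1, q2.
- split=> [[t tts /IH[a [q1 [q2 [r1 r2 ->]]]]]|[a [q1 [q2 [[t tts r1] r2 ->]]]]].
    by exists a, q1, q2; split=> //; exists t.
  by exists t => //; apply/IH; exists a, q1, q2.
Qed.

End Programs.

Section Runs.
Variables (R : realType) (E : finType) (k : nat) (f : ktuple E k -> R).

Lemma runs_ask_all (T : Type) (g : T -> ktuple E k) ts ps q :
  runs f (ask_all R g ts) ps q <->
  ps = [seq (t, f (g t)) | t <- ts] /\ q = size ts.
Proof.
elim: ts ps q => [|t ts IH] ps q //=; split.
  by case=> q' -> /runs_bind[r [_ [_ [/IH[-> ->] [-> ->] ->]]]]; rewrite addn0.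
case=> -> ->; exists (size ts) => //; apply/runs_bind.
by exists [seq (t, f (g t)) | t <- ts], (size ts), 0%N; rewrite addn0; split=> //; apply/IH.
Qed.

Lemma runs_ask_choose (T : eqType) (g : T -> ktuple E k) (le : rel (T * R)) ts t q :
  runs f (bind (ask_all R g ts) (choose_max E k le)) t q <->
  [/\ t \in ts, forall t', t' \in ts -> le (t', f (g t')) (t, f (g t)) & q = size ts].
Proof.
split=> [/runs_bind[_ [_ [_ [/runs_ask_all[-> ->] [t' t'max [-> ->]] ->]]]]|[tts tmax ->]].
  move: t'max => /mapP[p]; rewrite mem_filter => /andP[/allP pmax /mapP[t'' t''s pE]] ->.
  rewrite pE /=; split; rewrite ?addn0 // => u us.
  by rewrite -pE; apply/pmax/map_f.
apply/runs_bind; exists [seq (t, f (g t)) | t <- ts], (size ts), 0%N.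
split; rewrite ?addn0 //; first exact/runs_ask_all.
exists t => //; apply/mapP; exists (t, f (g t)) => //.
rewrite mem_filter map_f // andbT; apply/allP => _ /mapP[u us ->]; exact: tmax.
Qed.

Lemma runs_ask_argmax xs x q :
  runs f (ask_argmax R xs) x q <->
  [/\ x \in xs, forall y, y \in xs -> f y <= f x & q = size xs].
Proof. exact: runs_ask_choose. Qed.

End Runs.

(** * The greedy loop *)

Section Loop.
Variables (R : realType) (E : finType) (k : nat) (c : E -> nat) (L : int).
Variables (f : ktuple E k -> R) (f_mono : kmonotone f) (f_sub : ksubmodular f).
Implicit Types (x y s : ktuple E k) (e : E) (i : 'I_k) (S T A : {set E}).

Local Notation loop := (greedy_loop R c L).

(** An iteration asks one value for [s] and [#|A| * k] for the candidates. The converse direction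
    serves to build runs. *)
Lemma runs_loop_step m s A t q : A != set0 ->
  runs f (loop m.+1 s A) t q <->
  exists e i q', [/\ best_gain c f s A e i,
    runs f (loop m (if (cost c (ksupport s) + c e)%:Z <= L
                    then kjoin s (ksingle e i) else s) (A :\ e)) t q' &
    q = (#|A| * k + q').+1].
Proof.
move=> /negbTE A0; cbn [greedy_loop]; rewrite A0; cbn [runs].
set ts := [seq _ | e <- _, i <- _].
have tsE e i : ((e, i) \in ts) = (e \in A).
  apply/allpairsPdep/idP => [[e' [i' [e'A _ [-> _]]]]|eA]; first by rewrite -mem_enum.
  by exists e, i; rewrite !mem_enum.
have sz : size ts = (#|A| * k)%N by rewrite size_allpairs -cardE size_enum_ord.
split=> [[q0 -> /runs_bind[ps [q1 [q2 [rps /runs_bind[[e i] [q3 [q4 [re rt ->]]]] ->]]]]]|].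
  (* The queries and the choice, separated by the nesting of the binds, are regrouped into one
     run. *)
  have /runs_ask_choose[] : runs f (bind (ask_all R (fun ei : E * 'I_k =>
      kjoin s (ksingle ei.1 ei.2)) ts) (choose_max E k (gain_ratio_le c (f s)))) (e, i) (q1 + q3).
    by apply/runs_bind; exists ps, q1, q3.
  rewrite tsE sz => eA emax q13; exists e, i, q4; rewrite -q13 addnA; split=> //.
  split=> // e' i' e'A; apply: (emax (e', i')); by rewrite tsE.
case=> e [i [q' [[eA emax] rt ->]]].
have /runs_bind[ps [q1 [q2 [rps re q12]]]] : runs f (bind (ask_all R (fun ei : E * 'I_k =>
    kjoin s (ksingle ei.1 ei.2)) ts) (choose_max E k (gain_ratio_le c (f s)))) (e, i) (#|A| * k)%N.
  apply/runs_ask_choose; rewrite tsE sz; split=> // -[e' i']; rewrite tsE => e'A.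
  exact: emax.
exists (#|A| * k + q')%N => //; apply/runs_bind; exists ps, q1, (q2 + q')%N.
rewrite addnA -q12; split=> //; apply/runs_bind.
by exists (e, i), q2, q'.
Qed.

Lemma runs_loop0 m s t q : runs f (loop m s set0) t q <-> t = s /\ q = 0%N.
Proof. by case: m => //= m; rewrite eqxx. Qed.

Lemma runs_loop_queries m s A t q : (m <= #|E|)%N ->
  runs f (loop m s A) t q -> (q <= m * (#|E| * k).+1)%N.
Proof.
elim: m s A q => [|m IH] s A q mE; first by case=> _ ->.
have [->|A0] := eqVneq A set0; first by case/runs_loop0 => _ ->.
case/(runs_loop_step _ _ _ _ A0) => e [i [q' [_ /(IH _ _ _ (ltnW mE)) q'm ->]]].
by rewrite mulSn addSn ltnS leq_add // leq_mul2r max_card orbT.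
Qed.

Lemma ksupport_joinU s A e : e \in A ->
  ksupport s :|: A = (e |: ksupport s) :|: (A :\ e).
Proof.
move=> eA; apply/setP => e'; rewrite !inE.
by have [->|_] := eqVneq e' e; rewrite ?eA ?orbT ?orbF.
Qed.

Definition loop_state s A := A \subset ~: ksupport s /\ feasible c L s.

Lemma loop_state_step s A e i : loop_state s A -> e \in A ->
  loop_state (if (cost c (ksupport s) + c e)%:Z <= L
              then kjoin s (ksingle e i) else s) (A :\ e).
Proof.
move=> [As Ls] eA; have es : e \notin ksupport s by have := subsetP As _ eA; rewrite inE.
case: ifP => Le; last by split=> //; apply: subset_trans As; apply: subD1set.
rewrite /loop_state /feasible ksupport_join_single // costU1 // addnC Le.
split=> //; apply/subsetP => e'; rewrite !inE => /andP[/negbTE-> /(subsetP As)].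
by rewrite inE.
Qed.

Lemma runs_loop_le m s A t q : loop_state s A ->
  runs f (loop m s A) t q -> feasible c L t /\ f s <= f t.
Proof.
elim: m s A q => [|m IH] s A q sA; first by case=> -> _; case: sA.
have [A0|A0] := eqVneq A set0.
  by rewrite A0 => /runs_loop0[-> _]; case: sA.
case/(runs_loop_step _ _ _ _ A0) => e [i [q' [[eA _] /IH]]].
have := loop_state_step i sA eA; case: ifP => _ s'A /(_ s'A)[-> st] _ //.
split=> //; apply: le_trans st; apply/f_mono/kle_join_single.
by have := subsetP (proj1 sA) _ eA; rewrite inE.
Qed.

(** The inclusion of [o] in [s] and [A] says that no element of [o] has been rejected yet. The
    invariant is carried for every competitor [x], because the element to delete from [o] is known
    only at the first such rejection. *)
Lemma runs_loop_bound s0 o m s A t q :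
  feasible c L o -> kle s0 o -> 0 <= f s0 -> 0 <= f o ->
  (forall e, e \in ksupport o -> f o <= f (krestrict o [set~ e]) + f s0) ->
  loop_state s A -> (#|A| <= m)%N -> kle s0 s ->
  (forall x, kle s0 x -> ksupport x \subset ksupport s :|: A -> invariant c f s0 x s) ->
  ksupport o \subset ksupport s :|: A ->
  runs f (loop m s A) t q ->
  (1 - expR (- 2)) * f o <= 2 * f t.
Proof.
move=> Lo s0o f0 fo0 fo.
have e2 : 0 < 1 - expR (- 2) :> R by rewrite subr_gt0 expR_lt1; lra.
have e2' : 0 < expR (- 2) :> R by apply: expR_gt0.
(* If [s'] covers [o], the copy [y] equals [s'], and the invariant gives
   [f o + f s0 <= 2 * f s']. *)
have stop s' : ksupport o \subset ksupport s' -> invariant c f s0 o s' ->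
    (1 - expR (- 2)) * f o <= 2 * f s'.
  move=> os' [[y [s'y ys' foy]] _]; move: foy.
  rewrite -(kle_support_eq s'y); last by apply: (subset_trans ys'); rewrite subUset os' subxx.
  have : 0 <= expR (- 2) * f o by rewrite mulr_ge0 // ltW.
  lra.
elim: m s A q => [|m IH] s A q sA Am s0s inv oA.
  case=> -> _; apply: stop; last exact: inv.
  by move: Am oA; rewrite leqn0 cards_eq0 => /eqP->; rewrite setU0.
have [A0|A0] := eqVneq A set0.
  move: oA; rewrite A0 => oA /runs_loop0[-> _]; apply: stop; first by rewrite setU0 in oA.
  by apply: inv; rewrite ?A0.
move=> r; have [_ st] := runs_loop_le sA r; move: r.
case/(runs_loop_step _ _ _ _ A0) => e [i [q' [best r' _]]].
have [eA _] := best; have As := proj1 sA.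
have es : e \notin ksupport s by have := subsetP As _ eA; rewrite inE.
have A'm : (#|A :\ e| <= m)%N by move: Am; rewrite (cardsD1 e) eA.
have := loop_state_step i sA eA.
case: ifP r' => [Le r' s'A|Le r' s'A].
  apply: (IH _ _ _ s'A A'm) r'; rewrite ?ksupport_join_single // -?ksupport_joinU //.
    by apply: (kle_trans s0s); apply: kle_join_single.
  move=> x s0x xA.
  exact: invariant_step (inv x s0x xA) xA As best.
have inv' x : kle s0 x -> ksupport x \subset ksupport s :|: A :\ e -> invariant c f s0 x s.
  move=> s0x xA; apply: inv => //; apply: (subset_trans xA).
  by apply: setUS; apply: subD1set.
have [eo|eo] := boolP (e \in ksupport o); last first.
  apply: (IH _ _ _ s'A A'm) r' => //; apply/subsetP => e' e'o.
  have := subsetP oA _ e'o; rewrite !inE; case/orP => [->//|->].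
  by rewrite andbT; apply/orP; right; apply: contraNneq eo => <-.
set x := krestrict o [set~ e].
have s0x : kle s0 x.
  apply: kle_restrict => //; apply/subsetP => e' e'0; rewrite !inE.
  by apply: contraNneq es => <-; apply: (subsetP (kle_support s0s)).
have xo : ksupport x = ksupport o :\ e by rewrite ksupport_restrict setDE.
have xA : ksupport x \subset ksupport s :|: A.
  by apply: subset_trans oA; rewrite xo; apply: subD1set.
have [_ Ls] := sA.
(* A free element would fit, since [s] is feasible. *)
have ce : (0 < c e)%N.
  rewrite lt0n; apply: contraFN Le => /eqP ->; by rewrite addn0.
(* [cost x + c e = cost o <= L < cost s + c e]. *)
have xs : (cost c (ksupport x) <= cost c (ksupport s))%N.
  rewrite -(leq_add2r (c e)) addnC -costU1 xo ?inE ?eqxx // setD1K //.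
  move: Lo (negbT Le); rewrite -ltNge /feasible => Lo Lt.
  by have := le_lt_trans Lo Lt; rewrite ltz_nat => /ltnW.
have := invariant_bound f_mono f_sub s0x s0s (inv x s0x xA) xA As best f0 ce xs.
have := ler_wpM2l (ltW e2) (fo e eo); rewrite -/x.
lra.
Qed.

End Loop.

(* [ratio_le] is a lexicographic order, which makes it total and transitive. *)
Definition ratio_key (R : realType) (d : R) (a : nat) : R *l R :=
  if a is 0%N then (d, 0) else (0, d / a%:R).

(** Nonnegative gains settle the mixed cases: a zero-cost key has first component [d], and a
    positive gain there beats the first component [0] of every finite ratio. *)
Lemma ratio_leE (R : realType) (d d' : R) (a a' : nat) : 0 <= d -> 0 <= d' ->
  ratio_le d a d' a' = (ratio_key d a <= ratio_key d' a')%O.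
Proof.
move=> d0 d'0; case: a a' => [|a] [|a'] /=; rewrite Order.ProdLexiOrder.leEprodlexi /=.
- by rewrite lexx implybT andbT.
- by rewrite divr_ge0 ?implybT ?andbT.
- by rewrite d'0 ltNge orbC -implybE pmulr_lle0 // invr_gt0 ltr0n.
- by rewrite lexx.
Qed.

(** * Existence of runs, and the pass over all starts *)

Section Existence.
Variables (R : realType) (E : finType) (k : nat) (c : E -> nat) (L : int).
Variables (f : ktuple E k -> R) (f_mono : kmonotone f).
Implicit Types (x y s : ktuple E k) (e : E) (i : 'I_k) (A : {set E}).

Lemma best_gain_exists s A : (0 < k)%N -> A != set0 -> A \subset ~: ksupport s ->
  exists e i, best_gain c f s A e i.
Proof.
move=> k0 /set0Pn[e0 e0A] /subsetP As.
pose key (ei : E * 'I_k) := ratio_key (gain f s ei.1 ei.2) (c ei.1).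
have [[e i] /= eA emax] :=
  @arg_maxP _ _ _ (e0, Ordinal k0) (fun ei : E * 'I_k => ei.1 \in A) key e0A.
exists e, i; split=> // e' i' e'A.
have g0 e1 i1 : e1 \in A -> 0 <= gain f s e1 i1.
  by move=> /As; rewrite inE; apply: gain_ge0.
by rewrite ratio_leE ?g0 //; apply: (emax (e', i')).
Qed.

Lemma runs_loop_exists m s A : (0 < k)%N -> loop_state c L s A ->
  exists t q, runs f (greedy_loop R c L m s A) t q.
Proof.
move=> k0; elim: m s A => [|m IH] s A sA; first by exists s, 0%N.
have [->|A0] := eqVneq A set0; first by exists s, 0%N; apply/runs_loop0.
have [e [i best]] := best_gain_exists k0 A0 (proj1 sA).
have [t [q r]] := IH _ _ (loop_state_step i sA (proj1 best)).
by exists t, (#|A| * k + q).+1; apply/runs_loop_step => //; exists e, i, q.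
Qed.

Lemma runs_ask_argmax_exists xs : xs != [::] ->
  exists x q, runs f (ask_argmax R xs) x q.
Proof.
case: xs => // x0 xs _.
have [x xs_x xmax] := @arg_maxP _ _ _ x0 (mem (x0 :: xs)) f (mem_head _ _).
by exists x, (size (x0 :: xs)); apply/runs_ask_argmax.
Qed.

Lemma loop_state_start s : feasible c L s -> loop_state c L s (~: ksupport s).
Proof. by split. Qed.

Lemma runs_starts_exists starts s : (0 < k)%N -> all (feasible c L) starts ->
  exists t q, runs f (greedy_starts R c L starts s) t q.
Proof.
move=> k0; elim: starts s => [|s0 starts IH] s; first by exists s, 0%N.
move=> /andP[Ls0 Ls]; cbn [greedy_starts].
have [t [q r]] := runs_loop_exists #|~: ksupport s0| k0 (loop_state_start Ls0).
have [//|s' [q' r']] := @runs_ask_argmax_exists [:: s; t].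
have [t' [q'' r'']] := IH s' Ls.
exists t', (q + (q' + q''))%N; apply/runs_bind; exists t, q, (q' + q'')%N; split=> //.
by apply/runs_bind; exists s', q', q''.
Qed.

Lemma runs_starts starts s t q :
  all (feasible c L) starts -> feasible c L s ->
  runs f (greedy_starts R c L starts s) t q ->
  [/\ feasible c L t, f s <= f t &
    forall s0, s0 \in starts -> exists t0 q0,
      runs f (greedy_loop R c L #|~: ksupport s0| s0 (~: ksupport s0)) t0 q0 /\
      f t0 <= f t].
Proof.
elim: starts s q => [|s0 starts IH] s q; first by move=> _ Ls [->].
move=> Ls0 Ls; cbn [greedy_starts].
case/runs_bind => t0 [q0 [_ [r0 /runs_bind[s' [q1 [q2 [+ r2 _]]]] _]]].
case/runs_ask_argmax => s's s'max _.
have [Ls0' Lss] := andP Ls0.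
have [Lt0 _] := runs_loop_le f_mono (loop_state_start Ls0') r0.
have Ls' : feasible c L s' by move: s's; rewrite !inE => /orP[] /eqP->.
have [Lt s't H] := IH _ _ Lss Ls' r2; split=> //.
  by apply: le_trans s't; apply: s'max; rewrite mem_head.
move=> s1; rewrite inE => /orP[/eqP->|/H //]; exists t0, q0; split=> //.
by apply: le_trans s't; apply: s'max; rewrite !inE eqxx orbT.
Qed.

Lemma runs_starts_queries starts s t q :
  runs f (greedy_starts R c L starts s) t q ->
  (q <= size starts * (#|E| * (#|E| * k).+1 + 2))%N.
Proof.
elim: starts s q => [|s0 starts IH] s q; first by case=> _ ->.
cbn [greedy_starts size].
case/runs_bind => t0 [q0 [_ [/runs_loop_queries q0E /runs_bind[s' [q1 [q2 [+ /IH q2E ->]]]] ->]]].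
(* The 2 per start is the final comparison of [s] and [t]. *)
case/runs_ask_argmax => _ _ ->; rewrite mulSn addnA leq_add // leq_add2r.
apply: leq_trans (q0E (max_card _)) _.
by rewrite leq_mul2r max_card orbT.
Qed.

End Existence.

(** * Counting tuples of small support *)

(** A tuple with at most [m.+1] elements is empty or arises by adding one of [#|E| * k] pairs to a
    tuple with at most [m], so each step multiplies the count by at most [(#|E| * k).+1]. *)
Lemma card_ksupport_le (E : finType) (k m : nat) :
  (#|[set x : ktuple E k | #|ksupport x| <= m]| <= (#|E| * k).+1 ^ m)%N.
Proof.
elim: m => [|m IH].
  rewrite expn0.
  apply/card_le1_eqP => x y; rewrite !inE !leqn0 !cards_eq0 => /eqP x0 /eqP y0.
  apply: klabel_inj => e.
  have := ksupportE x e; have := ksupportE y e; rewrite x0 y0 !inE.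
  by case: (klabel x e) (klabel y e) => [?|] [?|].
set K := [set x | _] in IH.
pose add (p : ktuple E k * (E * 'I_k)) := kjoin p.1 (ksingle p.2.1 p.2.2).
have sub : [set x : ktuple E k | (#|ksupport x| <= m.+1)%N] \subset
    K :|: add @: setX K setT.
  apply/subsetP => x; rewrite !inE => xm.
  have [x0|[e]] := set_0Vmem (ksupport x); first by rewrite x0 cards0.
  rewrite ksupportE; case xe: (klabel x e) => [i|//] _; apply/orP; right.
  apply/imsetP; exists (krestrict x [set~ e], (e, i)); rewrite ?inE /= ?andbT.
    move: xm; rewrite ksupport_restrict -setDE (cardsD1 e) ksupportE xe.
    by rewrite add1n ltnS.
  by rewrite /add /= krestrictD1_join.
apply: leq_trans (subset_leq_card sub) _.
apply: leq_trans (leq_card_setU _ _) _.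
rewrite expnS mulSn leq_add //.
apply: leq_trans (leq_imset_card _ _) _.
rewrite cardsX cardsT card_prod card_ord mulnC leq_mul2l IH orbT //.
Qed.

(** * Approximation guarantee and query count *)

Section Main.
Variables (R : realType) (E : finType) (k : nat) (c : E -> nat) (L : int).
Variables (f : ktuple E k -> R) (f_mono : kmonotone f) (f_sub : ksubmodular f).
Hypothesis f_ge0 : forall x, 0 <= f x.
Implicit Types (x y s o : ktuple E k) (e : E) (i : 'I_k) (T : {set E}).

Let small := [seq x <- enum {: ktuple E k} | (#|ksupport x| <= 4 - 1)%N && feasible c L x].
Let starts := [seq x <- enum {: ktuple E k} | (#|ksupport x| == 4)%N && feasible c L x].

Lemma feasible_le x y : kle x y -> feasible c L y -> feasible c L x.
Proof.
move=> /kle_support xy; rewrite /feasible; apply: le_trans.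
by rewrite lez_nat; apply: costS.
Qed.

Lemma runs_greedy_exists o : (0 < k)%N -> feasible c L o ->
  exists s q, runs f (greedy R k c L 4) s q.
Proof.
move=> k0 Lo.
have /runs_ask_argmax_exists-/(_ R f)[s [q r]] : small != [::].
  (* The empty tuple is feasible because [o] is; for negative [L] the list would be empty and the
     choice stuck. *)
  suff : krestrict o set0 \in small by case: small.
  rewrite mem_filter mem_enum andbT ksupport_restrict setI0 cards0 /=.
  exact: feasible_le (@krestrict_le _ _ o set0) Lo.
have [|t [q' r']] := @runs_starts_exists R E k c L f f_mono starts s k0.
  by apply/allP => x; rewrite mem_filter => /andP[/andP[]].
by exists t, (q + q')%N; apply/runs_bind; exists s, q, q'.
Qed.

(** Take the best four-element restriction of [o]. The loss from deleting [e] is at most the gain of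
    [e] at the empty tuple, hence at most the value of [e] alone, hence of [e] with three other
    elements of [o]. *)
Lemma good_start o : (4 <= #|ksupport o|)%N ->
  exists s0, [/\ kle s0 o, #|ksupport s0| = 4 &
    forall e, e \in ksupport o -> f o <= f (krestrict o [set~ e]) + f s0].
Proof.
have subset_card T n : (n <= #|T|)%N -> exists2 U : {set E}, U \subset T & #|U| = n.
  move=> /card_geqP[r [Ur <- rT]]; exists [set x in r]; last by rewrite cardsE; apply/card_uniqP.
  by apply/subsetP => x; rewrite inE => /rT.
move=> /[dup] o4 /subset_card[T0 T0o T04].
pose P T := (T \subset ksupport o) && (#|T| == 4)%N.
have P0 : P T0 by rewrite /P T0o T04 eqxx.
have [T /andP[To /eqP T4] Tmax] := @arg_maxP _ _ _ T0 P (fun T => f (krestrict o T)) P0.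
exists (krestrict o T); split; first exact: krestrict_le.
  by rewrite ksupport_restrict (setIidPr To).
move=> e /[dup] eo; rewrite ksupportE; case oe: (klabel o e) => [i|//] _.
have /subset_card[U Uo U3] : (3 <= #|ksupport o :\ e|)%N.
  by move: o4; rewrite (cardsD1 e) eo.
have eU : e \notin U by apply/negP => /(subsetP Uo); rewrite !inE eqxx.
have : f (krestrict o (e |: U)) <= f (krestrict o T).
  apply: Tmax; rewrite /P cardsU1 eU U3 subUset sub1set eo.
  by rewrite (subset_trans Uo) // subD1set.
have : f (kjoin (krestrict o set0) (ksingle e i)) <= f (krestrict o (e |: U)).
  apply: f_mono; apply/kleP => e' j.
  rewrite kjoin_single /= !klabel_restrict !inE //.
  by case: eqVneq => //= ->; rewrite oe.
have := @gain_antimono _ _ _ _ f_sub (krestrict o set0) (krestrict o [set~ e]) e i.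
rewrite {1}/gain krestrictD1_join // notin_krestrictD1 /gain => /(_ _ isT) H.
have {}H := H _; have := f_ge0 (krestrict o set0).
suff /H : kle (krestrict o set0) (krestrict o [set~ e]) by lra.
by apply: kle_restrict; [exact: krestrict_le|rewrite ksupport_restrict setI0 sub0set].
Qed.

Lemma greedy_bound o s q : optimal f c L o ->
  runs f (greedy R k c L 4) s q ->
  feasible c L s /\ 2^-1 * (1 - expR (- 2)) * f o <= f s.
Proof.
move=> [Lo _] /runs_bind[s1 [q1 [q2 [/runs_ask_argmax[s1s s1max _] r _]]]].
have Lstarts : all (feasible c L) starts.
  by apply/allP => x; rewrite mem_filter => /andP[/andP[]].
have Ls1 : feasible c L s1 by move: s1s; rewrite mem_filter => /andP[/andP[]].
have [Ls s1s' H] := runs_starts f_mono Lstarts Ls1 r; split=> //.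
have e2 : 0 < expR (- 2) :> R by apply: expR_gt0.
have e2f : 0 <= expR (- 2) * f o by rewrite mulr_ge0 // ltW.
(* An optimum with at most three elements is already among the tuples of the first phase. *)
have [o3|o4] := leqP #|ksupport o| 3.
  have : f o <= f s1 by apply: s1max; rewrite mem_filter mem_enum o3 Lo.
  have := f_ge0 o; lra.
have [s0 [s0o s04 fo]] := good_start o4.
have Ls0 : feasible c L s0 by apply: feasible_le Lo.
have /H[t [q0 [rt ts]]] : s0 \in starts by rewrite mem_filter mem_enum s04 Ls0.
have : (1 - expR (- 2)) * f o <= 2 * f t.
  apply: (runs_loop_bound f_mono f_sub Lo s0o) rt => //.
  - by move=> x s0x _; apply: invariant_start.
  - by rewrite setUCr subsetT.
lra.
Qed.

(** With [M = #|E| * k], the target is [M ^ 4 * (#|E| * M)]. Each phase lists at most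
    [(2 * M) ^ 4 = 16 * M ^ 4] tuples and a start costs at most [4 * (#|E| * M)] queries, whence
    [80 = 16 * 4 + 16]. *)
Lemma greedy_queries s q : (0 < k)%N -> (0 < #|E|)%N ->
  runs f (greedy R k c L 4) s q -> (q <= 80 * (#|E| ^ 6 * k ^ 5))%N.
Proof.
move=> k0 E0 /runs_bind[s1 [q1 [q2 [/runs_ask_argmax[_ _ ->] /runs_starts_queries q2E ->]]]].
have size_le (P : pred (ktuple E k)) : (forall x, P x -> #|ksupport x| <= 4)%N ->
    (size [seq x <- enum {: ktuple E k} | P x] <= (#|E| * k).+1 ^ 4)%N.
  move=> P4; apply: leq_trans (card_ksupport_le E k 4).
  rewrite -(card_uniqP (filter_uniq P (enum_uniq _))); apply: subset_leq_card.
  by apply/subsetP => x; rewrite mem_filter inE => /andP[/P4].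
set M := (#|E| * k)%N in size_le q2E *.
have M0 : (0 < M)%N by rewrite muln_gt0 E0.
have -> : (#|E| ^ 6 * k ^ 5 = M ^ 4 * (#|E| * M))%N by rewrite /M !expnS expn0; lia.
have M4 : (M.+1 ^ 4 <= 16 * M ^ 4)%N.
  by rewrite -[16%N]/(2 ^ 4)%N -expnMn leq_exp2r // mul2n -addnn -add1n leq_add2r.
have nM : (#|E| * M.+1 + 2 <= 4 * (#|E| * M))%N by nia.
have nM0 : (0 < #|E| * M)%N by rewrite muln_gt0 E0.
have small_le : (size small <= 16 * M ^ 4)%N.
  by apply: leq_trans M4; apply: size_le => x /andP[/leqW].
have starts_le : (size starts <= 16 * M ^ 4)%N.
  by apply: leq_trans M4; apply: size_le => x /andP[/eqP->].
have := leq_trans q2E (leq_mul starts_le nM).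
have : (size small <= 16 * M ^ 4 * (#|E| * M))%N.
  by apply: leq_trans small_le _; rewrite leq_pmulr.
rewrite -/small; lia.
Qed.

End Main.

(** Existence of a run keeps the claim about all runs from being vacuous. For empty [E] the query
    bound would be 0, while a feasible empty tuple is still queried. *)
Theorem theorem1 :
  exists C : nat,
  forall (R : realType) (E : finType) (k : nat) (c : E -> nat) (L : int)
    (f : ktuple E k -> R),
  (0 < k)%N ->
  (forall x, 0 <= f x) ->
  kmonotone f ->
  ksubmodular f ->
  (forall o : ktuple E k, optimal f c L o ->
     (exists s q, runs f (greedy R k c L 4) s q) /\
     (forall s q, runs f (greedy R k c L 4) s q ->
        feasible c L s /\ f s >= 2^-1 * (1 - expR (- 2)) * f o)) /\
  ((0 < #|E|)%N ->
   forall s q, runs f (greedy R k c L 4) s q ->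
     (q <= C * (#|E| ^ 6 * k ^ 5))%N).
Proof.
exists 80%N => R E k c L f k0 f0 f_mono f_sub; split=> [o oP|E0 s q].
  split; first by have [Lo _] := oP; apply: (runs_greedy_exists _ k0 Lo).
  by move=> s q; apply: greedy_bound.
exact: greedy_queries.
Qed.
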